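(* Let $n\ge 3$ be an integer with $n \equiv 0$ or $3 \pmod 4$, and let $H_n$ be the graph obtained from the complete graph $K_n$ by adding, for each pair $\{u,w\}$ of distinct vertices of $K_n$, a new vertex adjacent exactly to $u$ and $w$ (all edges of $K_n$ being kept). Then $\chi_{\mathsf{odd}}(H_n) = n$. In particular, since each $H_n$ is a split graph, the odd chromatic number is unbounded on split graphs, and hence on graphs with no induced path on five vertices ($P_5$-free graphs).
   Context: All graphs are finite, simple and undirected. A graph is called odd if every vertex has odd degree. $\chi_{\mathsf{odd}}(G)$, the odd chromatic number of $G$, is the minimum number of odd induced subgraphs of $G$ whose vertex sets partition $V(G)$. (By a theorem of Scott, such a partition exists if and only if every connected component of $G$ has even order.) A split graph is a graph whose vertex set can be partitioned into a clique and an independent set. *)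

(* Defs.v *)
From mathcomp Require Import all_boot.

Set Implicit Arguments.
Unset Strict Implicit.
Unset Printing Implicit Defensive.

Record sgraph := SGraph {
  vertex :> finType;
  edge : rel vertex;
  edge_sym : symmetric edge;
  edge_irrefl : irreflexive edge
}.

Definition degree (G : sgraph) (x : G) : nat := #|[set y | edge x y]|.

Definition odd_graph (G : sgraph) : bool := [forall x : G, odd (degree x)].

Section Induced.
Variables (G : sgraph) (A : {set G}).

Definition induced_edge : rel {x : G | x \in A} :=
  fun x y => edge (val x) (val y).

Lemma induced_edge_sym : symmetric induced_edge.
Proof. by move=> x y; apply: edge_sym. Qed.

Lemma induced_edge_irrefl : irreflexive induced_edge.
Proof. by move=> x; apply: edge_irrefl. Qed.

Definition induced : sgraph := SGraph induced_edge_sym induced_edge_irrefl.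
End Induced.

Definition odd_partition (G : sgraph) (P : {set {set G}}) : bool :=
  partition P [set: G] && [forall A in P, odd_graph (induced A)].

(* None exactly when G has no partition into odd induced subgraphs. *)
Definition chi_odd (G : sgraph) : option nat :=
  if [pick P : {set {set G}} | odd_partition P] is Some P0
  then Some #|[arg min_(P < P0 | odd_partition P) #|P|]|
  else None.

Definition clique (G : sgraph) (K : {set G}) : Prop :=
  {in K &, forall x y, x != y -> edge x y}.

Definition independent (G : sgraph) (S : {set G}) : Prop :=
  {in S &, forall x y, ~~ edge x y}.

Definition split_graph (G : sgraph) : Prop :=
  exists K : {set G}, clique K /\ independent (~: K).

Section PathGraph.
Variable k : nat.

Definition path_edge : rel 'I_k := fun i j => (i.+1 == j) || (j.+1 == i).

Lemma path_edge_sym : symmetric path_edge.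
Proof. by move=> i j; rewrite /path_edge orbC. Qed.

Lemma path_edge_irrefl : irreflexive path_edge.
Proof. by move=> i; rewrite /path_edge orbb eqn_leq ltnn. Qed.

Definition path_graph : sgraph := SGraph path_edge_sym path_edge_irrefl.
End PathGraph.

Definition induced_free (F G : sgraph) : Prop :=
  ~ exists f : F -> G,
      injective f /\ forall x y : F, edge (f x) (f y) = edge x y.

Definition P5_free (G : sgraph) : Prop := induced_free (path_graph 5) G.

(* A graph with no partition into odd induced subgraphs never witnesses
   unboundedness. *)
Definition chi_odd_unbounded_on (C : sgraph -> Prop) : Prop :=
  forall m : nat, exists G : sgraph, C G /\
    exists2 k : nat, chi_odd G = Some k & m < k.

Section HGraph.
Variable n : nat.

(* inl u is a vertex of the complete graph on n vertices; inr e is the vertex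
   added for the pair e of distinct vertices. *)
Definition H_vertex : finType :=
  ('I_n + {e : {set 'I_n} | #|e| == 2})%type.

Definition H_edge : rel H_vertex := fun x y =>
  match x, y with
  | inl u, inl v => u != v
  | inl u, inr e => u \in val e
  | inr e, inl u => u \in val e
  | inr _, inr _ => false
  end.

Lemma H_edge_sym : symmetric H_edge.
Proof. by move=> [u|e] [v|f] //=; rewrite eq_sym. Qed.

Lemma H_edge_irrefl : irreflexive H_edge.
Proof. by move=> [u|e] //=; rewrite eqxx. Qed.

Definition H : sgraph := SGraph H_edge_sym H_edge_irrefl.
End HGraph.

(* Main.v *)
Require Import Defs.
From mathcomp Require Import all_boot zify.

Set Implicit Arguments.
Unset Strict Implicit.
Unset Printing Implicit Defensive.

(** In an odd partition, the vertex attached to a pair {u, w} must share its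
    part with exactly one of u and w; so u and w lie in distinct parts, and
    there are at least n parts.  Conversely, choosing for each pair the end
    whose part it joins amounts to orienting K_n, and the resulting n parts are
    stars centred at the vertices of K_n; they are odd when all out-degrees are
    odd.  Such an orientation arises from the transitive tournament by reversing
    edges {i, i+1} so as to correct the parities one vertex after the other.  A
    split graph contains no induced 2K_2, hence no induced P_5. *)

Lemma degree_induced (G : sgraph) (A : {set G}) (x : induced A) :
  degree x = #|[set y in A | edge (val x) y]|.
Proof.
rewrite /degree -(card_imset _ val_inj); apply: eq_card => y.
apply/imsetP/idP => [[z]|]; first by rewrite !inE => xz ->; rewrite (valP z).
by rewrite inE => /andP[Ay xy]; exists (Sub y Ay) => //; rewrite inE.
Qed.

Lemma odd_graph_induced (G : sgraph) (A : {set G}) :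
  reflect {in A, forall x, odd #|[set y in A | edge x y]|}
          (odd_graph (induced A)).
Proof.
apply: (iffP forallP) => [oddA x Ax | oddA x]; last first.
  by rewrite degree_induced; apply/oddA/valP.
by have := oddA (Sub x Ax); rewrite degree_induced.
Qed.

Lemma chi_odd_eq (G : sgraph) (k : nat) (P : {set {set G}}) :
  odd_partition P -> #|P| = k ->
  (forall Q : {set {set G}}, odd_partition Q -> k <= #|Q|) ->
  chi_odd G = Some k.
Proof.
rewrite /chi_odd => oddP cardP minP; case: pickP => [P0 oddP0 | /(_ P)]; last first.
  by rewrite oddP.
case: arg_minnP => // Q oddQ minQ; congr Some; apply/eqP.
by rewrite eqn_leq minP // -cardP minQ.
Qed.

(** Parity is additive over symmetric differences, so each reversed edge's effect on an out-degree
    can be counted separately. *)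
Lemma odd_card_addb (T : finType) (p q : pred T) :
  odd #|[pred x | p x (+) q x]| = odd #|p| (+) odd #|q|.
Proof.
have oddE (r : pred T) : odd #|r| = \big[addb/false]_x r x.
  rewrite -sum1_card big_mkcond (big_morph odd oddD (erefl : odd 0 = false)).
  by apply: eq_bigr => x _; rewrite unfold_in; case: (r x).
by rewrite !oddE -big_split.
Qed.

Section Fibres.
Variables (T I : finType) (f : T -> I) (g : I -> T).
Hypothesis gK : cancel g f.

Definition fibres : {set {set T}} := [set f @^-1: [set i] | i in I].

Lemma fibres_partition : partition fibres [set: T].
Proof.
apply/and3P; split.
- apply/eqP/setP=> x; rewrite inE; apply/bigcupP.
  by exists (f @^-1: [set f x]); rewrite ?inE //; apply: imset_f.
- apply/trivIsetP => _ _ /imsetP[i _ ->] /imsetP[j _ ->] neq_ij.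
  rewrite -setI_eq0; apply/eqP/setP => x; rewrite !inE.
  apply: contraNF neq_ij => /andP[/eqP fxi /eqP fxj].
  by rewrite -fxi -fxj.
- apply/imsetP => -[i _ /setP/(_ (g i))].
  by rewrite !inE gK eqxx.
Qed.

Lemma card_fibres : #|fibres| = #|I|.
Proof.
rewrite card_imset // => i j /setP/(_ (g i)).
by rewrite !inE gK eqxx => /esym/eqP.
Qed.

End Fibres.

(* Reversing {i, i+1} exactly when i = 0 or 1 mod 4 makes the out-degrees odd. *)
Definition beats : rel nat := fun i j =>
  (j < i) (+) (((j == i.+1) && (i %% 4 < 2)) (+) ((i == j.+1) && (j %% 4 < 2))).

(** The reversal term is symmetric in [i] and [j], so swapping them negates only the comparison. *)
Lemma beatsN i j : i != j -> beats j i = ~~ beats i j.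
Proof.
move=> neq_ij; rewrite /beats -addNb -leqNgt [i <= j]leq_eqVlt (negbTE neq_ij).
by congr addb; apply: addbC.
Qed.

Lemma beats_irrefl i : beats i i = false.
Proof. by rewrite /beats ltnn ltn_eqF. Qed.

(** The transitive tournament gives [i] out-degree [i]; reversals of {i, i+1} and {i-1, i} make it
    odd in each class mod 4. The last vertex has no successor, but [n - 1] is 2 or 3 mod 4, so no
    reversal was due there. *)
Lemma odd_out_degree (n : nat) (i : 'I_n) :
  n = 0 %[mod 4] \/ n = 3 %[mod 4] -> odd #|[pred j : 'I_n | beats i j]|.
Proof.
move=> n03; rewrite /beats !odd_card_addb.
have -> : #|[pred j : 'I_n | j < i]| = i.
  rewrite -[RHS]card_ord -!sum1_card.
  by rewrite (big_ord_widen n (fun=> 1) (ltnW (ltn_ord i))).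
have card_eq m (b : pred nat) :
    #|[pred j : 'I_n | (j == m :> nat) && b j]| = (m < n) && b m.
  have [lt_mn|le_nm] := ltnP m n; last first.
    apply: eq_card0 => j; rewrite inE; case: eqP => // jm.
    by have := ltn_ord j; lia.
  case: (boolP (b m)) => bm.
    rewrite (@eq_card _ _ (pred1 (Ordinal lt_mn))) ?card1 // => j.
    by rewrite !inE -val_eqE /=; case: eqP => // ->.
  by apply: eq_card0 => j; rewrite inE; case: eqP => // ->; apply: negbTE.
rewrite (card_eq _ (fun=> i %% 4 < 2)).
(* The guard [0 < i] discards the truncated predecessor [0.-1 = 0]. *)
have -> : #|[pred j : 'I_n | (i == j.+1 :> nat) && (j %% 4 < 2)]|
          = (0 < i) && (i.-1 %% 4 < 2).
  case: (posnP i) => [i0|i_gt0]; first by apply: eq_card0 => j; rewrite inE i0.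
  have := card_eq i.-1 (fun j => j %% 4 < 2).
  rewrite (leq_ltn_trans (leq_pred i) (ltn_ord i)) => <-; apply: eq_card => j.
  by rewrite !inE; congr andb; lia.
have := ltn_ord i; rewrite !oddb; lia.
Qed.

Section OddChromaticH.
Variable n : nat.

Lemma split_H : split_graph (H n).
Proof.
exists [set x : H n | if x is inl _ then true else false]; split.
  by case=> [u|e] [v|d]; rewrite !inE.
by case=> [u|e] [v|d]; rewrite !inE.
Qed.

Lemma odd_partition_H_geq (P : {set {set H n}}) : odd_partition P -> n <= #|P|.
Proof.
case/andP=> /[dup] partP /and3P[/eqP coverP triv _] /forall_inP oddP.
have inP (x : H n) : x \in cover P by rewrite coverP inE.
rewrite -[leqLHS]card_ord -(@card_imset _ _ (fun u => pblock P (inl u : H n))).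
  by apply/subset_leq_card/subsetP => _ /imsetP[u _ ->]; apply: pblock_mem.
move=> u w eq_uw; apply: contraTeq isT => neq_uw.
have card_uw : #|[set u; w]| == 2 by rewrite cards2 neq_uw.
(* With [u] and [w] in one part, [x] has degree 2 inside its own part if that part is theirs, and 0
   otherwise: never odd. *)
pose x : H n := inr (Sub [set u; w] card_uw).
have /odd_graph_induced/(_ x) := oddP _ (pblock_mem (inP x)).
rewrite mem_pblock inP => /(_ isT).
have same_w v : (inl v \in pblock P x) = (pblock P x == pblock P (inl v : H n)).
  by rewrite eq_pblock.
case: (boolP (inl u \in pblock P x)) => xu; last first.
  rewrite (_ : [set y in _ | _] = set0) ?cards0 //.
  apply/setP=> -[v|d]; rewrite !inE /= ?andbF //.
  apply: contraNF xu => /andP[xv /set2P[]] vE; first by rewrite -vE.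
  by rewrite same_w eq_uw -vE -same_w.
rewrite (_ : [set y in _ | _] = inl @: [set u; w]); last first.
  apply/setP=> -[v|d]; rewrite inE /= ?andbF.
    rewrite mem_imset; last by move=> ? ? [].
    rewrite !inE; case: eqP => [->|_]; first by rewrite xu.
    by case: eqP => [->|_]; rewrite ?andbF // same_w -eq_uw -same_w xu.
  by apply/esym/imsetP => -[].
by rewrite card_imset ?(eqP card_uw) // => ? ? [].
Qed.

(** The tail of the oriented edge serves; the condition is boolean so that [xchoose] can extract
    it. *)
Lemma owner_exists (e : {e : {set 'I_n} | #|e| == 2}) :
  exists u, (u \in val e) && [forall w in val e, (w != u) ==> beats u w].
Proof.
case: e => e /= /cards2P[u [w [neq_uw ->]]].
wlog uw : u w neq_uw / beats u w.
  move=> IH; have [/IH|/negbTE uw] := boolP (beats u w); first exact.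
  rewrite setUC; apply: IH; first by rewrite eq_sym.
  by rewrite beatsN // uw.
exists u; rewrite !inE eqxx; apply/forall_inP => v; rewrite !inE.
by case/orP=> /eqP ->; rewrite ?eqxx ?uw ?implybT.
Qed.

Definition owner (x : H n) : 'I_n :=
  match x with inl u => u | inr e => xchoose (owner_exists e) end.

Lemma owner_inl : cancel (inl : 'I_n -> H n) owner.
Proof. by []. Qed.

Lemma owner_in (e : {e : {set 'I_n} | #|e| == 2}) : owner (inr e) \in val e.
Proof. by have /andP[] := xchooseP (owner_exists e). Qed.

Lemma owner_beats (e : {e : {set 'I_n} | #|e| == 2}) (w : 'I_n) :
  w \in val e -> w != owner (inr e) -> beats (owner (inr e)) w.
Proof.
have /andP[_ /forall_inP ownerP] := xchooseP (owner_exists e).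
by move=> /ownerP/implyP; apply.
Qed.

Lemma card_owned (u : 'I_n) :
  #|[set y in owner @^-1: [set u] | H_edge (inl u) y]|
  = #|[pred w : 'I_n | beats u w]|.
Proof.
have pairP w : u != w -> #|[set u; w]| == 2 by move=> uw; rewrite cards2 uw.
(* Sends an out-neighbour [w] of [u] to the vertex attached to {u, w}. The default [inl u] arises
   only for [w = u], which [beats u w] excludes. *)
pose spoke w : H n := if insub [set u; w] is Some e then inr e else inl u.
have spokeE w (uw : u != w) : spoke w = inr (Sub [set u; w] (pairP w uw)).
  rewrite /spoke insubT ?pairP // => card_uw.
  by congr inr; apply: val_inj.
have neq (w : 'I_n) : beats u w -> u != w.
  by apply: contraTneq => <-; rewrite beats_irrefl.
rewrite -(@card_in_imset _ _ spoke); last first.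
  move=> v w; rewrite !inE => /neq uv /neq uw; rewrite !spokeE => -[/setP/(_ v)].
  by rewrite !inE eqxx orbT [v == u]eq_sym (negbTE uv) => /esym/eqP.
apply: eq_card => y; apply/idP/imsetP => [|[w]].
  case: y => [v|e]; rewrite !inE /=; first by rewrite eq_sym; case: eqP.
  case/andP=> /eqP eu ue.
  have [v [eE uv]] : exists v, sval e = [set u; v] /\ u != v.
    have /cards2P[a [b [ab eE]]] : #|sval e| == 2 := valP e.
    move: ue; rewrite eE => /set2P[->|->]; first by exists b.
    by exists a; rewrite setUC eq_sym.
  exists v.
    have ve : v \in sval e by rewrite eE set22.
    by have := owner_beats ve; rewrite /= eu eq_sym => /(_ uv).
  by rewrite spokeE; congr inr; apply: val_inj.
rewrite [w \in _]inE => uw ->; have neq_uw := neq _ uw; rewrite spokeE.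
set e := Sub _ _; rewrite !inE; apply/andP; split; last exact: set21.
(* Were [w] the owner, it would beat [u], against [beats u w]. *)
apply: contraT => neq_eu; have /set2P[] := owner_in e; first by move/eqP/idPn.
move=> ew; have := @owner_beats e u (set21 u w); rewrite ew => /(_ neq_uw).
by rewrite beatsN // uw.
Qed.

Lemma fibres_owner_odd :
  n = 0 %[mod 4] \/ n = 3 %[mod 4] -> odd_partition (fibres owner).
Proof.
move=> n03; rewrite /odd_partition (fibres_partition owner_inl).
apply/forall_inP => _ /imsetP[u _ ->]; apply/odd_graph_induced => -[v|e].
  by rewrite !inE /= => /eqP ->; rewrite card_owned odd_out_degree.
(* A leaf of the star: its only neighbour in the part is the centre [u]. *)
rewrite !inE => /eqP eu.
rewrite (_ : [set y in _ | _] = [set inl u]) ?cards1 //.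
apply/setP=> -[v|d]; rewrite !inE /= ?andbF //.
by apply/andb_idr => /eqP ->; rewrite -eu owner_in.
Qed.

Lemma chi_odd_H : n = 0 %[mod 4] \/ n = 3 %[mod 4] -> chi_odd (H n) = Some n.
Proof.
move=> n03; apply: (chi_odd_eq (fibres_owner_odd n03)).
  by rewrite (card_fibres owner_inl) card_ord.
exact: odd_partition_H_geq.
Qed.

End OddChromaticH.

(** Every edge of the path meets the clique, as the complement is independent. The edges {0, 1} and
    {3, 4} thus yield two distinct clique vertices that are nonadjacent on the path. *)
Lemma split_P5_free (G : sgraph) : split_graph G -> P5_free G.
Proof.
case=> K [cliK indK] [f [f_inj fE]].
have meetsK (i j : 'I_5) : path_edge i j -> exists2 x, x \in [:: i; j] & f x \in K.
  move=> ij; have [|Ki] := boolP (f i \in K); first by exists i; rewrite ?inE ?eqxx.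
  exists j; rewrite ?inE ?eqxx ?orbT //; apply: contraTT ij => Kj.
  by rewrite -[path_edge i j]fE; apply: indK; rewrite inE.
have [x x01 Kx] := meetsK (inord 0) (inord 1) ltac:(by rewrite /path_edge !inordK).
have [y y34 Ky] := meetsK (inord 3) (inord 4) ltac:(by rewrite /path_edge !inordK).
have {}x01 : x < 2 by move: x01; rewrite !inE => /orP[] /eqP ->; rewrite inordK.
have {}y34 : 2 < y by move: y34; rewrite !inE => /orP[] /eqP ->; rewrite inordK.
have := cliK _ _ Kx Ky; rewrite (inj_eq f_inj) fE -val_eqE /= /path_edge.
lia.
Qed.

Lemma chi_odd_unbounded_on_split : chi_odd_unbounded_on split_graph.
Proof.
(* A multiple of 4 exceeding [m]. *)
move=> m; exists (H (4 * m.+1)); split; first exact: split_H.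
exists (4 * m.+1); last by lia.
by apply: chi_odd_H; left; rewrite modnMr.
Qed.

Theorem mainTheorem10 :
  (forall n : nat, 3 <= n -> n = 0 %[mod 4] \/ n = 3 %[mod 4] ->
     chi_odd (H n) = Some n /\ split_graph (H n)) /\
  chi_odd_unbounded_on split_graph /\
  chi_odd_unbounded_on P5_free.
Proof.
split=> [n _ n03|]; first by split; [apply: chi_odd_H | apply: split_H].
split=> [|m]; first exact: chi_odd_unbounded_on_split.
have [G [splitG chiG]] := chi_odd_unbounded_on_split m.
by exists G; split=> //; apply: split_P5_free.
Qed.
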